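(* Consider the conditionally Gaussian model of the context (with $\psi$ bounded) and suppose that the contraction assumption of the context holds for some $r_c>0$. Then for all $r=\sigma/\gamma\in[0,r_c)$ there is a constant $c$, independent of $\gamma$, such that $$\limsup_{k\to\infty}\ \mathbb{E}\,\bigl\|u_k-\mathbb{E}^{\mu_k}u_k\bigr\|^2\ \le\ c\,\gamma^2,$$ where $\mathbb{E}^{\mu_k}$ denotes expectation with respect to the filtering distribution $\mu_k$ (so $\mathbb{E}^{\mu_k}u_k$ is the mean of $\mu_k$) and $\mathbb{E}$ denotes expectation over the dynamical model and the observational data.
   Context: $\mathcal{X}$ and $\mathcal{Y}$ are finite-dimensional Euclidean spaces. Model. $\psi:\mathcal{X}\to\mathcal{X}$ is bounded (and measurable), $H:\mathcal{X}\to\mathcal{Y}$ is linear, and $$u_{k+1}=\psi(u_k)+\xi_k,\qquad y_{k+1}=Hu_{k+1}+\eta_{k+1},$$ with $u_0\sim\mu_0$ (a probability measure on $\mathcal{X}$), $\xi_k\sim N(0,\Sigma)$ i.i.d., $\eta_k\sim N(0,\Gamma)$ i.i.d., and $u_0,\{\xi_k\},\{\eta_k\}$ independent. Here $\Sigma=\sigma^2\Sigma_0$, $\Gamma=\gamma^2\Gamma_0$ with $\Sigma_0,\Gamma_0$ strictly positive definite and fixed, and $\sigma,\gamma\in(0,\infty)$, $r:=\sigma/\gamma\in(0,\infty)$. Filtering distribution. $\mu_k$ is the conditional law of $u_k$ given $Y_k=(y_1,\dots,y_k)$, where the data are generated by the model above. Kalman gain. $S=H\Sigma H^*+\Gamma$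 and $K=\Sigma H^*S^{-1}=r^2\Sigma_0H^*(r^2H\Sigma_0H^*+\Gamma_0)^{-1}$, which depends on $\sigma,\gamma$ only through $r$. Contraction assumption (with $r_c>0$). $\|\cdot\|$ is a norm on $\mathcal{X}$ and, for all $r\in[0,r_c)$, the function $(I-KH)\psi(\cdot)$ is globally Lipschitz on $\mathcal{X}$ with respect to $\|\cdot\|$ with Lipschitz constant $\alpha=\alpha(r)<1$. *)

(* Defs.v *)
From HB Require Import structures.
From mathcomp Require Import all_boot all_order all_algebra.
From mathcomp Require Import finmap.
From mathcomp Require Import all_classical all_reals all_analysis.

Set Implicit Arguments.
Unset Strict Implicit.
Unset Printing Implicit Defensive.

Import Order.TTheory GRing.Theory Num.Theory.
Import numFieldNormedType.Exports.

Local Open Scope classical_set_scope.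
Local Open Scope ring_scope.

(* Euclidean spaces are taken in orthonormal coordinates: R^n is 'cV[R]_n,
   linear maps are matrices and adjoints are transposes. *)

(* Borel sigma-algebra of the space of matrices (in particular of R^n) *)
HB.instance Definition _ (R : realType) (m n : nat) :=
  @isMeasurable.Build (sigma_display (@open 'M[R]_(m, n))) 'M[R]_(m, n)
    <<s @open 'M[R]_(m, n) >> (@sigma_algebra0 _ setT open)
    (@sigma_algebraC _ open) (@sigma_algebra_bigcup _ setT open).

Definition posdefmx (R : realType) (n : nat) (A : 'M[R]_n) : Prop :=
  A^T = A /\ forall x : 'cV[R]_n, x != 0 -> 0 < (x^T *m A *m x) 0 0.

(* An arbitrary norm on R^n; the library's norm on 'cV[R]_n is the sup norm. *)
Definition is_norm (R : realType) (n : nat) (N : 'cV[R]_n -> R) : Prop :=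
  [/\ forall x y, N (x + y) <= N x + N y,
      forall a x, N (a *: x) = `|a| * N x
    & forall x, N x = 0 -> x = 0].

(* N(0, S) for S positive definite: every nonzero linear functional <t, .> has
   law N(0, <t, S t>) on R. The second parameter of [normal_prob] is the
   standard deviation. *)
Definition centered_gaussian (R : realType) (n : nat) (S : 'M[R]_n)
    (mu : set 'cV[R]_n -> \bar R) : Prop :=
  forall t : 'cV[R]_n, t != 0 -> forall A : set R, measurable A ->
    mu [set x | A ((t^T *m x) 0 0)] =
    normal_prob 0 (Num.sqrt ((t^T *m S *m t) 0 0)) A.

Definition mutually_independent (d : measure_display) (T : measurableType d)
    (R : realType) (P : probability T R) (I : choiceType)
    (F : I -> set (set T)) : Prop :=
  forall (J : {fset I}) (E : I -> set T), (forall i, i \in J -> F i (E i)) ->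
    P (\bigcap_(i in [set` J]) E i) = (\prod_(i <- J) P (E i))%E.

Definition kalman_gain (R : realType) (n m : nat) (H : 'M[R]_(m, n))
    (Sigma : 'M[R]_n) (Gamma : 'M[R]_m) : 'M[R]_(n, m) :=
  Sigma *m H^T *m invmx (H *m Sigma *m H^T + Gamma).

(* For Sigma = sigma^2 Sigma0, Gamma = gamma^2 Gamma0 the Kalman gain depends
   only on r = sigma / gamma: it is the gain of (r^2 Sigma0, Gamma0). *)
Definition contraction_assumption (R : realType) (n m : nat)
    (psi : 'cV[R]_n -> 'cV[R]_n) (H : 'M[R]_(m, n))
    (Sigma0 : 'M[R]_n) (Gamma0 : 'M[R]_m) (N : 'cV[R]_n -> R) (rc : R) : Prop :=
  forall r : R, 0 <= r < rc ->
    let f x := (1%:M - kalman_gain H (r ^+ 2 *: Sigma0) Gamma0 *m H) *m psi x in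
    exists2 alpha : R, alpha < 1 &
      forall u v, N (f u - f v) <= alpha * N (u - v).

(* The independent sources of randomness: u_0, (xi_k)_{k >= 0} and
   (eta_k)_{k >= 1}, given by the sigma-algebras they generate. *)
Definition model_sources (d : measure_display) (T : measurableType d)
    (R : realType) (P : probability T R) (n m : nat)
    (u xi : nat -> {RV P >-> 'cV[R]_n}) (eta : nat -> {RV P >-> 'cV[R]_m})
    (i : option (nat + nat)) : set (set T) :=
  match i with
  | None => g_sigma_algebra_preimage (u 0%N)
  | Some (inl k) => g_sigma_algebra_preimage (xi k)
  | Some (inr k) => g_sigma_algebra_preimage (eta k.+1)
  end.

(* The values y 0 and eta 0 are unconstrained and play no role. *)
Record gaussian_model (d : measure_display) (T : measurableType d)
    (R : realType) (P : probability T R) (n m : nat)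
    (psi : 'cV[R]_n -> 'cV[R]_n) (H : 'M[R]_(m, n))
    (Sigma : 'M[R]_n) (Gamma : 'M[R]_m) (mu0 : probability 'cV[R]_n R)
    (u xi : nat -> {RV P >-> 'cV[R]_n})
    (y eta : nat -> {RV P >-> 'cV[R]_m}) : Prop := GaussianModel {
  model_state : forall k w, u k.+1 w = psi (u k w) + xi k w ;
  model_obs : forall k w, y k.+1 w = H *m u k.+1 w + eta k.+1 w ;
  model_init : forall A, measurable A -> distribution P (u 0%N) A = mu0 A ;
  model_noise : forall k, centered_gaussian Sigma (distribution P (xi k)) ;
  model_obs_noise :
    forall k, centered_gaussian Gamma (distribution P (eta k.+1)) ;
  model_indep : mutually_independent P (model_sources u xi eta)
}.

Definition data (d : measure_display) (T : measurableType d) (R : realType)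
    (P : probability T R) (m : nat) (y : nat -> {RV P >-> 'cV[R]_m})
    (k : nat) (w : T) : k.-tuple 'cV[R]_m :=
  [tuple y i.+1 w | i < k].

(* kappa is a regular version of the conditional law of U given Z *)
Definition is_conditional_law (d d1 d2 : measure_display)
    (T : measurableType d) (T1 : measurableType d1) (T2 : measurableType d2)
    (R : realType) (P : probability T R) (Z : T -> T1) (U : T -> T2)
    (kappa : R.-pker T1 ~> T2) : Prop :=
  forall (B : set T1) (A : set T2), measurable B -> measurable A ->
    P (Z @^-1` B `&` U @^-1` A) = (\int[P]_(w in Z @^-1` B) kappa (Z w) A)%E.

Definition mean (R : realType) (n : nat)
    (mu : {measure set 'cV[R]_n -> \bar R}) : 'cV[R]_n :=
  \col_i (\int[mu]_x x i 0)%R.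

(* Main.v *)
Require Import Defs.
From HB Require Import structures.
From mathcomp Require Import all_boot all_order all_algebra.
From mathcomp Require Import all_classical all_reals all_analysis.
From mathcomp Require Import measurable_realfun.
From mathcomp Require Import ring lra.

Import Order.TTheory GRing.Theory Num.Theory.
Import numFieldNormedType.Exports.

Local Open Scope classical_set_scope.
Local Open Scope ring_scope.

(** The filter mean is the best mean square estimate of the state among all
    functions of the data, so its error is at most that of any explicit
    estimator. The estimator used here is the 3DVAR filter [observer]:
    [v 0 = 0] and [v k.+1 = (I - K H) psi (v k) + K y_(k+1)], where [K] is the
    Kalman gain of the given ratio [r]. Its error [e k = u k - v k] satisfies
    [e k.+1 = ((I - K H) psi (u k) - (I - K H) psi (v k)) + zeta k] with
    [zeta k = (I - K H) xi k - K eta_(k+1)] ([observer_error]).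

    The first term is at most [a * N (e k)] with [a < 1] by the contraction
    assumption, so by convexity of the square ([convex_sqr_le])
    [E N (e k.+1) ^+ 2 <= a * E N (e k) ^+ 2 + E N (zeta k) ^+ 2 / (1 - a)],
    and no independence is needed. As [sigma = r * gamma], the noise has
    [E N (zeta k) ^+ 2 <= D0 * gamma ^+ 2] with [D0] depending only on [r]
    ([noise_mean_square_le], [gaussian_sqnorm_le]). The recursion starts at
    [k = 1], where boundedness of [psi] makes the error square integrable
    although nothing is known about the moments of [u 0]
    ([observer_mean_square_init]). Iterating gives
    [E N (e k.+1) ^+ 2 <= a ^+ k * b + D0 / (1 - a) ^+ 2 * gamma ^+ 2], and the
    first term is eventually below [gamma ^+ 2].

    Optimality of the filter mean ([conditional_mean_best]) comes from the
    disintegration [ge0_conditional_expectation] of the joint law of data and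
    state together with the fact that, under any probability, the mean
    minimises the mean square distance to a constant
    ([integral_sqr_sub_mean_le]); this needs no integrability. It is a
    statement about each coordinate, hence about the Euclidean norm, and is
    transferred to the norm [N] by equivalence of norms
    ([conditional_mean_norm_le]). *)

Set Implicit Arguments.
Unset Strict Implicit.

(** * Borel measurability of matrix-valued functions *)

Section borel_matrix.
Context {R : realType}.

Lemma open_measurable_mx p q (A : set 'M[R]_(p, q)) : open A -> measurable A.
Proof. by move=> oA; apply: sub_sigma_algebra. Qed.

Lemma continuous_measurable_mx p q (f : 'M[R]_(p, q) -> R) :
  continuous f -> measurable_fun setT f.
Proof.
move=> /continuousP cf.
apply: (measurability _ (RGenOInfty.measurableE R)) => _ [_ [x ->] <-].
rewrite setTI; apply: open_measurable_mx; apply: cf.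
exact: interval_open.
Qed.

Lemma measurable_coord p q i j :
  measurable_fun setT (fun A : 'M[R]_(p, q) => A i j).
Proof. by apply: continuous_measurable_mx; exact: coord_continuous. Qed.

(** Holds because an open set of matrices is a countable union of sup-norm
    balls with rational centres and radii, and a ball is a finite intersection
    of coordinate strips. *)
Lemma measurable_fun_mx d (T : measurableType d) p q (f : T -> 'M[R]_(p, q)) :
  (forall i j, measurable_fun setT (fun x => f x i j)) -> measurable_fun setT f.
Proof.
move=> mf.
(* The radii are opaque, so that [lra] treats them as atoms. *)
have [rad radE] : {rad : nat -> R | forall k, rad k = k.+1%:R^-1}.
  by exists (fun k => k.+1%:R^-1).
pose c (t : 'M[rat]_(p, q) * nat) : 'M[R]_(p, q) := map_mx ratr t.1.
pose B (t : 'M[rat]_(p, q) * nat) : set 'M[R]_(p, q) :=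
  [set x | forall i j, `|x i j - c t i j| < rad t.2].
have mB t : measurable (f @^-1` B t).
  have -> : f @^-1` B t =
      \bigcap_(ij in [set: 'I_p * 'I_q])
        (fun x => `|f x ij.1 ij.2 - c t ij.1 ij.2|) @^-1` `]-oo, rad t.2[.
    apply/seteqP; split => x /= Bx.
      by move=> ij _ /=; rewrite in_itv/=; exact: Bx.
    by move=> i j; have := Bx (i, j) I; rewrite /= in_itv.
  apply: fin_bigcap_measurable => // ij _; rewrite -[X in measurable X]setTI.
  have : measurable_fun setT (fun x => `|f x ij.1 ij.2 - c t ij.1 ij.2|).
    by apply: measurableT_comp => //; exact: measurable_funB.
  by move=> h; apply: h => //; exact: measurable_itv.
have mE : @measurable _ 'M[R]_(p, q) = <<s @open 'M[R]_(p, q) >> by [].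
apply: (measurability _ mE) => _ [V oV <-].
rewrite setTI.
have -> : f @^-1` V = \bigcup_(t in [set t | B t `<=` V]) (f @^-1` B t).
  apply/seteqP; split => x /= => [Vx|[t /= BV]]; last exact: BV.
  have /nbhs_ballP[e /= e0 eV] : nbhs (f x) V by exact: open_nbhs_nbhs.
  have [k ke] : exists k : nat, rad k < e / 2 :> R.
    have [k _ /(_ k (leqnn k))ke] :=
      near_infty_natSinv_lt (PosNum (divr_gt0 e0 (ltr0Sn R 1))).
    by exists k; rewrite radE.
  have /choice[g gP] : forall ij : 'I_p * 'I_q, exists r : rat,
      `|f x ij.1 ij.2 - ratr r| < rad k.
    move=> ij.
    have [|r] := @rat_in_itvoo R (f x ij.1 ij.2 - rad k)
      (f x ij.1 ij.2 + rad k).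
      have k0 : (0 : R) < rad k by rewrite radE invr_gt0.
      by lra.
    rewrite in_itv/= => /andP[r1 r2]; exists r.
    by rewrite ltr_norml; apply/andP; split; lra.
  exists (\matrix_(i, j) g (i, j), k) => /=; last first.
    by move=> i j; rewrite !mxE; exact: (gP (i, j)).
  move=> z /= Bz; apply: eV; split => // i j.
  have := Bz i j; have := gP (i, j); rewrite !mxE/= /ball/= => h1 h2.
  rewrite (_ : _ - _ = (f x i j - ratr (g (i, j))) - (z i j - ratr (g (i, j))));
    last by ring.
  by rewrite (le_lt_trans (ler_normB _ _))//; lra.
rewrite bigcup_mkcond; apply: countable_bigcupT_measurable => [|t].
  exact: countableP.
by case: ifP.
Qed.

End borel_matrix.

(** * Norms on column vectors *)

(** The squared Euclidean norm of a column vector. *)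
Definition sqnorm (R : realType) (n : nat) (x : 'cV[R]_n) : R :=
  \sum_i x i 0 ^+ 2.

Section norms.
Context {R : realType}.

Lemma sqnorm_ge0 n (x : 'cV[R]_n) : 0 <= sqnorm x.
Proof. by apply: sumr_ge0 => i _; exact: sqr_ge0. Qed.

Lemma le_coord_sqnorm n (x : 'cV[R]_n) i : x i 0 ^+ 2 <= sqnorm x.
Proof.
rewrite /sqnorm (bigD1 i)//= lerDl; apply: sumr_ge0 => j _; exact: sqr_ge0.
Qed.

Context {n : nat} {N : 'cV[R]_n -> R} (N_norm : is_norm N).

Let ND x y : N (x + y) <= N x + N y. Proof. by case: N_norm. Qed.
Let NZ a x : N (a *: x) = `|a| * N x. Proof. by case: N_norm. Qed.

Lemma is_norm0 : N 0 = 0.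
Proof. by rewrite -(scale0r 0) NZ normr0 mul0r. Qed.

Lemma is_normN x : N (- x) = N x.
Proof. by rewrite -scaleN1r NZ normrN1 mul1r. Qed.

Lemma is_norm_ge0 x : 0 <= N x.
Proof. by have := ND x (- x); rewrite subrr is_norm0 is_normN; lra. Qed.

Lemma is_normB_le x y : N (x - y) <= N x + N y.
Proof. by rewrite (le_trans (ND _ _))// is_normN. Qed.

Lemma is_norm_sum I (r : seq I) (F : I -> 'cV[R]_n) :
  N (\sum_(i <- r) F i) <= \sum_(i <- r) N (F i).
Proof.
elim/big_ind2 : _ => //; first by rewrite is_norm0.
by move=> x a y b xa yb; rewrite (le_trans (ND _ _))// lerD.
Qed.

Lemma is_norm_mulmx_le p (A : 'M[R]_(n, p)) (x : 'cV[R]_p) :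
  N (A *m x) <= \sum_j `|x j 0| * N (col j A).
Proof.
rewrite (_ : A *m x = \sum_j x j 0 *: col j A).
  by rewrite (le_trans (is_norm_sum _ _))//; apply: ler_sum => j _; rewrite NZ.
apply/matrixP => i k; rewrite ord1 !mxE summxE; apply: eq_bigr => j _.
by rewrite !mxE mulrC.
Qed.

Lemma is_norm_mulmx_sqr p (A : 'M[R]_(n, p)) : exists2 C : R, 0 <= C &
  forall x : 'cV[R]_p, N (A *m x) ^+ 2 <= C * sqnorm x.
Proof.
exists ((\sum_j N (col j A)) ^+ 2); first exact: sqr_ge0.
move=> x; have le : N (A *m x) <= (\sum_j N (col j A)) * Num.sqrt (sqnorm x).
  rewrite (le_trans (is_norm_mulmx_le _ _))// mulr_suml; apply: ler_sum => j _.
  rewrite mulrC ler_wpM2l ?is_norm_ge0// -sqrtr_sqr ler_wsqrtr//.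
  exact: le_coord_sqnorm.
rewrite -[sqnorm x]sqr_sqrtr ?sqnorm_ge0// -exprMn lerXn2r// nnegrE.
  exact: is_norm_ge0.
exact: le_trans (is_norm_ge0 _) le.
Qed.

Lemma is_norm_sqnorm_le : exists2 C : R, 0 <= C &
  forall x, N x ^+ 2 <= C * sqnorm x.
Proof.
have [C C0 CP] := is_norm_mulmx_sqr 1%:M.
by exists C => // x; rewrite -[X in N X]mul1mx.
Qed.

Lemma ler_coord_normr p q (x : 'M[R]_(p, q)) i j : `|x i j| <= `|x|.
Proof.
rewrite [leRHS]/Num.norm/= mx_normrE.
exact: (@le_bigmax _ _ _ _ (fun ij => `|x ij.1 ij.2|) (i, j)).
Qed.

Lemma sqnorm_le_normr (x : 'cV[R]_n) : sqnorm x <= n%:R * `|x| ^+ 2.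
Proof.
rewrite mulr_natl -[X in _ *+ X](card_ord n) -sumr_const; apply: ler_sum => i _.
rewrite -real_normK ?num_real// lerXn2r ?nnegrE//.
exact: ler_coord_normr.
Qed.

Lemma normr_trmx p q (x : 'M[R]_(p, q)) : `|x^T| = `|x|.
Proof.
have le p' q' (y : 'M[R]_(p', q')) : `|y^T| <= `|y|.
  rewrite [leLHS]/Num.norm/= mx_normrE; apply/bigmax_leP; split=> // -[i j] _ /=.
  by rewrite mxE; exact: ler_coord_normr.
by apply/eqP; rewrite eq_le le/= -[X in `|X| <= _]trmxK le.
Qed.

Lemma is_norm_continuous : continuous N.
Proof.
have [C C0 CP] := is_norm_sqnorm_le.
have lip x y : `|N x - N y| <= Num.sqrt (C * n%:R) * `|x - y|.
  have h : N (x - y) <= Num.sqrt (C * n%:R) * `|x - y|.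
    rewrite -(@ler_pXn2r _ 2) ?nnegrE ?is_norm_ge0 ?mulr_ge0 ?sqrtr_ge0//.
    rewrite exprMn sqr_sqrtr ?mulr_ge0 ?ler0n// -mulrA (le_trans (CP _))//.
    by rewrite ler_wpM2l// sqnorm_le_normr.
  apply: le_trans h; rewrite ler_norml.
  have := ND (x - y) y; rewrite subrK => h1.
  have := ND (y - x) x; rewrite subrK -opprB is_normN => h2.
  by apply/andP; split; lra.
move=> x; apply/(@cvgrPdist_le _ _ _ (nbhs x) (nbhs_filter x)) => e e0.
pose K := Num.sqrt (C * n%:R) + 1.
have K0 : 0 < K by rewrite /K ltr_wpDl ?sqrtr_ge0.
near=> y; rewrite (le_trans (lip _ _))//.
have xy : `|x - y| <= e / K by near: y; apply: cvgr_dist_le => //; exact: divr_gt0.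
rewrite -[e](divfK (lt0r_neq0 K0)) mulrC ler_pM ?sqrtr_ge0//.
by rewrite /K lerDl.
Unshelve. all: by end_near. Qed.

(** Compactness of the unit sphere: [N] attains a positive minimum on it. *)
Lemma sqnorm_is_norm_le : exists2 C : R, 0 <= C &
  forall x, sqnorm x <= C * N x ^+ 2.
Proof.
(* The compactness theorem is about row vectors, hence the transpositions. *)
pose S : set 'rV[R]_n := [set x | `|x| = 1].
have [[v Sv]|S0] := pselect (S !=set0); last first.
  exists 0 => // x; have [->|x0] := eqVneq x 0.
    by rewrite mul0r /sqnorm big1// => i _; rewrite mxE expr0n.
  exfalso; apply: S0; exists (`|x|^-1 *: x)^T.
  by rewrite /S/= normr_trmx normrZ normfV normr_id mulVf// normr_eq0.
have cS : compact S.
  apply: bounded_closed_compact.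
    by exists 1; split => // M M1 x /= ->; exact: ltW.
  rewrite (_ : S = (@Num.norm _ 'rV[R]_n) @^-1` [set 1]); last by [].
  by apply: closed_comp => [x _|]; [exact: norm_continuous|exact: closed_eq].
have ctr : continuous (fun x : 'rV[R]_n => N x^T).
  move=> x; apply: (@continuous_comp _ _ _ trmx N); last exact: is_norm_continuous.
  apply/(@cvgrPdist_le _ _ _ (nbhs x) (nbhs_filter x)) => e e0; near=> y.
  rewrite (_ : _ - _ = (x - y)^T); last by rewrite linearB.
  by rewrite normr_trmx; near: y; exact: cvgr_dist_le.
have [||c /set_mem Sc cmin] :=
  @compact_EVT_min _ _ (fun x : 'rV[R]_n => N x^T) S _ cS.
- by exists v.
- exact: continuous_subspaceT.
have Nc0 : 0 < N c^T.
  rewrite lt_neqAle is_norm_ge0 andbT eq_sym; apply/eqP => Nc.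
  have c0 : c^T = 0 by case: N_norm => _ _; exact.
  by move: Sc; rewrite /S/= -normr_trmx c0 normr0 => /esym/eqP; rewrite oner_eq0.
exists (n%:R / N c^T ^+ 2) => [|x]; first by rewrite divr_ge0// ltW// exprn_gt0.
have [->|x0] := eqVneq x 0.
  rewrite /sqnorm big1 ?mulr_ge0 ?invr_ge0 ?sqr_ge0 ?is_norm_ge0//.
  by move=> i _; rewrite mxE expr0n.
rewrite (le_trans (sqnorm_le_normr _))// -mulrA ler_wpM2l// mulrC.
rewrite ler_pdivlMr ?exprn_gt0// -exprMn lerXn2r ?nnegrE ?mulr_ge0 ?is_norm_ge0//.
have nx0 : 0 < `|x| by rewrite normr_gt0.
have := cmin (`|x|^-1 *: x)^T; rewrite trmxK NZ normfV normr_id.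
rewrite ler_pdivlMl// => -> //; apply/mem_set.
by rewrite /S/= normr_trmx normrZ normfV normr_id mulVf// gt_eqF.
Unshelve. all: by end_near. Qed.

End norms.

(** * Second moments of Gaussian vectors *)

Section gaussian_moment.
Context {R : realType}.

(** The density of [normal_prob] is its Radon-Nikodym derivative. *)
Lemma ge0_integral_normal_prob (s : R) (f : R -> \bar R) :
  measurable_fun setT f -> (forall x, 0 <= f x)%E ->
  (\int[normal_prob 0 s]_x f x =
   \int[lebesgue_measure]_x (f x * (normal_pdf 0 s x)%:E))%E.
Proof.
move=> mf f0.
have dom := normal_prob_dominates 0 s.
rewrite -(Radon_Nikodym_SigmaFinite.change_of_variables dom)//.
have mRN := measurable_int _ (Radon_Nikodym_SigmaFinite.f_integrable dom).
apply: ae_eq_integral => //.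
- exact: emeasurable_funM.
- apply: emeasurable_funM => //; apply/measurable_EFinP.
  exact: measurable_normal_pdf.
- apply: ae_eqe_mul2l; apply: integral_ae_eq => //.
  + exact: Radon_Nikodym_SigmaFinite.f_integrable.
  + by apply/measurable_EFinP; exact: measurable_normal_pdf.
  + by move=> E _ mE; rewrite -(Radon_Nikodym_SigmaFinite.f_integral dom).
Qed.

(** Since [t <= expR t] for [t = x ^+ 2 / (4 * s ^+ 2)], the density of
    N(0, s^2) times [x ^+ 2] is at most a constant multiple of the density of
    N(0, 2 s^2). *)
Lemma sqr_normal_pdf_le (s x : R) : 0 < s ->
  x ^+ 2 * normal_pdf 0 s x <=
  4 * Num.sqrt 2 * s ^+ 2 * normal_pdf 0 (Num.sqrt 2 * s) x.
Proof.
move=> s0; have t0 : 0 < Num.sqrt 2 * s by rewrite mulr_gt0// sqrtr_gt0.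
rewrite !normal_pdfE ?gt_eqF// /normal_peak /normal_fun !subr0.
rewrite exprMn sqr_sqrtr//.
have -> : Num.sqrt (2 * s ^+ 2 * pi *+ 2) =
    Num.sqrt 2 * Num.sqrt (s ^+ 2 * pi *+ 2).
  by rewrite -sqrtrM//; congr (Num.sqrt _); ring.
set c := Num.sqrt (s ^+ 2 * pi *+ 2).
have c0 : 0 < c.
  by rewrite sqrtr_gt0 pmulrn_lgt0// mulr_gt0 ?pi_gt0// exprn_gt0.
pose y := x ^+ 2 / (4 * s ^+ 2).
have -> : - x ^+ 2 / (s ^+ 2 *+ 2) = - y - y.
  by rewrite /y; field; rewrite gt_eqF.
have -> : - x ^+ 2 / (2 * s ^+ 2 *+ 2) = - y.
  by rewrite /y; field; rewrite gt_eqF.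
have -> : x ^+ 2 = 4 * s ^+ 2 * y by rewrite /y; field; rewrite gt_eqF.
have q0 : Num.sqrt 2 != 0 :> R by rewrite gt_eqF// sqrtr_gt0.
have -> : 4 * Num.sqrt 2 * s ^+ 2 * ((Num.sqrt 2 * c)^-1 * expR (- y)) =
          4 * s ^+ 2 * (c^-1 * expR (- y)).
  by field; rewrite q0 gt_eqF.
rewrite -(mulrA (4 * s ^+ 2) y).
apply: ler_wpM2l; first by rewrite mulr_ge0 ?sqr_ge0.
rewrite mulrCA; apply: ler_wpM2l; first by rewrite invr_ge0 ltW.
rewrite expRD mulrA ler_piMl ?expR_ge0//.
rewrite expRN ler_pdivrMr ?expR_gt0// mul1r.
by rewrite (le_trans _ (expR_ge1Dx _))// lerDr.
Qed.

Lemma normal_prob_second_moment_le (s : R) : 0 < s ->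
  (\int[normal_prob 0 s]_x (x ^+ 2)%:E <= (4 * Num.sqrt 2 * s ^+ 2)%:E)%E.
Proof.
move=> s0; rewrite ge0_integral_normal_prob; last 2 first.
- by apply/measurable_EFinP; exact: measurable_funX.
- by move=> x; rewrite lee_fin sqr_ge0.
pose C := 4 * Num.sqrt 2 * s ^+ 2.
have C0 : 0 <= C by rewrite !mulr_ge0 ?sqrtr_ge0 ?exprn_ge0 ?(ltW s0).
apply: (@le_trans _ _ (\int[lebesgue_measure]_x
    (C%:E * (normal_pdf 0 (Num.sqrt 2 * s) x)%:E))%E).
  apply: ge0_le_integral => //=.
  - by move=> x _; rewrite -EFinM lee_fin mulr_ge0 ?sqr_ge0 ?normal_pdf_ge0.
  - apply: emeasurable_funM; apply/measurable_EFinP; first exact: measurable_funX.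
    exact: measurable_normal_pdf.
  - apply: emeasurable_funM; apply/measurable_EFinP => //.
    exact: measurable_normal_pdf.
  - by move=> x _; rewrite -!EFinM lee_fin sqr_normal_pdf_le.
rewrite ge0_integralZl//=.
- by rewrite integral_normal_pdf mule1.
- by apply/measurable_EFinP; exact: measurable_normal_pdf.
- by move=> x _; rewrite lee_fin normal_pdf_ge0.
Qed.

Lemma posdefmx_diag_gt0 n (S : 'M[R]_n) i : posdefmx S -> 0 < S i i.
Proof.
case=> _ /(_ (delta_mx i 0)); rewrite trmx_delta -rowE -colE !mxE; apply.
by apply/eqP => /matrixP/(_ i 0); rewrite !mxE !eqxx => /eqP; rewrite oner_eq0.
Qed.

Lemma gaussian_coord_second_moment_le d (T : measurableType d)
    (P : probability T R) n (S : 'M[R]_n) (X : {RV P >-> 'cV[R]_n}) i :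
  0 < S i i -> centered_gaussian S (distribution P X) ->
  (\int[P]_w (X w i 0 ^+ 2)%:E <= (4 * Num.sqrt 2 * S i i)%:E)%E.
Proof.
move=> Sii gX.
have mXi : measurable_fun setT (fun w => X w i 0).
  exact: (measurableT_comp (measurable_coord i 0)).
have t0 : delta_mx i 0 != 0 :> 'cV[R]_n.
  by apply/eqP => /matrixP/(_ i 0); rewrite !mxE !eqxx => /eqP; rewrite oner_eq0.
have h := gX _ t0.
have e1 : ((delta_mx i 0 : 'cV[R]_n)^T *m S *m (delta_mx i 0 : 'cV[R]_n)) 0 0 =
    S i i.
  by rewrite trmx_delta -rowE -colE !mxE.
have e2 (x : 'cV[R]_n) : ((delta_mx i 0 : 'cV[R]_n)^T *m x) 0 0 = x i 0.
  by rewrite trmx_delta -rowE !mxE.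
have s0 : 0 < Num.sqrt (S i i) by rewrite sqrtr_gt0.
have := normal_prob_second_moment_le s0; rewrite sqr_sqrtr ?(ltW Sii)//.
(* [normal_prob] is a measure on [measurableTypeR R], which has the same
   measurable sets as [R] but another display. *)
pose Xi : T -> measurableTypeR R := fun w => X w i 0.
have mXi' : measurable_fun setT Xi by exact: mXi.
pose mXi_mixin := isMeasurableFun.Build _ _ _ _ Xi mXi'.
pose X' : {RV P >-> measurableTypeR R} := HB.pack Xi mXi_mixin.
have <- : (\int[distribution P X']_x (x ^+ 2)%:E = \int[P]_w (X w i 0 ^+ 2)%:E)%E.
  rewrite ge0_integral_distribution//.
    by apply/measurable_EFinP; exact: measurable_funX.
  by move=> x; rewrite lee_fin sqr_ge0.
rewrite (@eq_measure_integral _ _ _ _ (distribution P X')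
  (normal_prob 0 (Num.sqrt (S i i))))// => A mA _.
have := h A mA; rewrite e1 => hA; refine (eq_trans (esym hA) _).
rewrite /distribution /pushforward/=; congr (P _).
by apply/funext => w /=; rewrite e2.
Qed.

End gaussian_moment.

(** * Disintegration along a conditional law *)

(** The image of [mu] under [f], bundled as a measure; measurability of [f] is
    passed explicitly. *)
Definition image_measure d1 d2 (T1 : measurableType d1) (T2 : measurableType d2)
    (R : realType) (mu : {measure set T1 -> \bar R}) (f : T1 -> T2)
    (mf : measurable_fun setT f) : {measure set T2 -> \bar R} :=
  measure_function_pushforward__canonical__measure_function_Measure mu mf.

Section graph_kernel.
Context d d1 d2 (T : measurableType d) (T1 : measurableType d1)
  (T2 : measurableType d2) (R : realType) (kappa : R.-pker T1 ~> T2)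
  (Z : {mfun T >-> T1}).

Let mpair (z : T1) : measurable_fun setT (pair z : T2 -> T1 * T2).
Proof. exact: pair1_measurable. Qed.

(** The kernel sending [w] to the law of [(Z w, x)] for [x] of law
    [kappa (Z w)]; the dummy argument in [unit] makes it composable with a
    probability seen as a constant kernel. *)
Definition graph_kernel (w : unit * T) : {measure set (T1 * T2) -> \bar R} :=
  image_measure (kappa (Z w.2)) (mpair (Z w.2)).

Let graph_kernel_measurable (A : set (T1 * T2)) : measurable A ->
  measurable_fun setT (graph_kernel ^~ A).
Proof.
move=> mA.
rewrite [X in measurable_fun _ X](_ : _ =
    (fun z => kappa z (xsection A z)) \o (Z \o snd)); last first.
  by apply/funext => w /=; rewrite xsectionE.
apply: measurableT_comp; last exact: measurableT_comp.
by apply: measurable_fun_xsection_finite_kernel; exact: mem_set.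
Qed.

HB.instance Definition _ :=
  isKernel.Build _ _ _ _ _ graph_kernel graph_kernel_measurable.

Let graph_kernelT w : graph_kernel w setT = 1%E.
Proof. by rewrite /= /pushforward preimage_setT prob_kernel. Qed.

HB.instance Definition _ :=
  Kernel_isProbability.Build _ _ _ _ _ graph_kernel graph_kernelT.

End graph_kernel.

Section disintegration.
Context d d1 d2 (T : measurableType d) (T1 : measurableType d1)
  (T2 : measurableType d2) (R : realType) (P : probability T R)
  (Z : {mfun T >-> T1}) (U : T -> T2) (kappa : R.-pker T1 ~> T2).
Hypotheses (mU : measurable_fun setT U)
  (kappaP : is_conditional_law P Z U kappa).

(** The joint law of [(Z, U)] is the law of [Z] followed by [kappa]. *)
Lemma ge0_conditional_expectation (f : T1 * T2 -> \bar R) :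
  measurable_fun setT f -> (forall z, 0 <= f z)%E ->
  (\int[P]_w f (Z w, U w) = \int[P]_w \int[kappa (Z w)]_x f (Z w, x))%E.
Proof.
move=> mf f0.
have mZU : measurable_fun setT (fun w => (Z w, U w)).
  exact: measurable_fun_pair.
pose l := kprobability
  (measurable_cst (P : pprobability T R) : measurable_fun [set: unit] _).
pose k := graph_kernel kappa Z.
have joint (A : set (T1 * T2)) : measurable A ->
    P ((fun w => (Z w, U w)) @^-1` A) = mkcomp l k tt A.
  (* Both sides are probabilities that agree on measurable rectangles. *)
  move=> mA; apply: (measure_unique
    [set A `*` B | A in measurable & B in measurable]
    (fun=> setT) _ _ _ _ (image_measure P mZU) (mkcomp l k tt)) => //.
  - exact: measurable_prod_measurableType.
  - move=> _ _ [X1 mX1 [X2 mX2 <-]] [Y1 mY1 [Y2 mY2 <-]].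
    exists (X1 `&` Y1); first exact: measurableI.
    by exists (X2 `&` Y2); [exact: measurableI|rewrite setXI].
  - by move=> _; exists setT => //; exists setT => //; rewrite setXTT.
  - exact: bigcup_const.
  - move=> _ [B mB [C mC <-]]; rewrite /= /pushforward.
    rewrite [LHS](kappaP mB mC) integral_mkcond; apply: eq_integral => w _.
    rewrite /k/= /pushforward patchE -xsectionE; case: ifPn => wB.
      by rewrite in_xsectionX.
    by rewrite notin_xsectionX ?measure0.
  - by move=> _; rewrite /= /pushforward preimage_setT probability_setT ltry.
transitivity (\int[mkcomp l k tt]_z f z)%E.
  rewrite -[LHS](@ge0_integral_pushforward _ _ _ _ R _ mZU P setT f)//.
  by apply: eq_measure_integral => A mA _; exact: joint.
rewrite integral_kcomp//; apply: eq_integral => w _.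
by rewrite /k/graph_kernel/= ge0_integral_pushforward.
Qed.

End disintegration.

(** * The conditional mean is the best mean square estimate *)

Section mean_square.
Context d (T : measurableType d) (R : realType) (nu : {measure set T -> \bar R}).
Hypothesis nuT : nu setT = 1%E.

Let integrable_cst1 (k : R) : nu.-integrable setT (fun=> k%:E).
Proof.
apply/integrableP; split => //.
by rewrite integral_cst//= nuT mule1 ltry.
Qed.

(** When the right hand side is finite, [X] is integrable and the difference of
    the two sides is [(mean - a) ^+ 2]; otherwise there is nothing to prove, and
    [Rintegral] may then be a default value. *)
Lemma integral_sqr_sub_mean_le (X : T -> R) (a : R) : measurable_fun setT X ->
  (\int[nu]_x ((X x - Rintegral nu setT X) ^+ 2)%:E <=
   \int[nu]_x ((X x - a) ^+ 2)%:E)%E.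
Proof.
move=> mX; have [->|fin] := eqVneq (\int[nu]_x ((X x - a) ^+ 2)%:E)%E +oo%E.
  exact: leey.
have mY : measurable_fun setT (fun x => X x - a) by exact: measurable_funB.
have iY2 : nu.-integrable setT (fun x => ((X x - a) ^+ 2)%:E).
  apply/integrableP; split; first by apply/measurable_EFinP; exact: measurable_funX.
  under eq_integral do rewrite gee0_abs ?lee_fin ?sqr_ge0//.
  by rewrite ltey.
have iY : nu.-integrable setT (fun x => (X x - a)%:E).
  apply: (@le_integrable _ _ _ nu _ measurableT _
    (fun x => (1%:E + ((X x - a) ^+ 2)%:E)%E)) => //.
  - exact/measurable_EFinP.
  - move=> x _; rewrite -EFinD !abse_EFin lee_fin [leRHS]ger0_norm; last first.
      by rewrite addr_ge0 ?sqr_ge0.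
    rewrite ler_norml; move: (X x - a) => y.
    have := sqr_ge0 (y - 1); have := sqr_ge0 (y + 1); have := sqr_ge0 y.
    (* [`|y| <= 1 + y ^+ 2] *)
    by rewrite sqrrB sqrrD => *; apply/andP; split; lra.
  - exact: integrableD.
have iX : nu.-integrable setT (fun x => (X x)%:E).
  have := integrableD measurableT iY (integrable_cst1 a).
  by apply: eq_integrable => // x _; rewrite /= -EFinD subrK.
set m := Rintegral nu setT X.
have mE : (\int[nu]_x (X x)%:E = m%:E)%E.
  by rewrite /m /Rintegral fineK// integrable_fin_num.
have EY : (\int[nu]_x (X x - a)%:E = (m - a)%:E)%E.
  under eq_integral do rewrite EFinB.
  by rewrite integralB//= mE integral_cst//= nuT mule1.
have -> : (\int[nu]_x ((X x - m) ^+ 2)%:E = \int[nu]_x (((X x - a) ^+ 2)%:E +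
   ((- (2 * (m - a)))%:E * (X x - a)%:E + ((m - a) ^+ 2)%:E)))%E.
  by apply: eq_integral => x _; rewrite -EFinM -!EFinD; congr EFin; ring.
have iZ := integrableZl measurableT (- (2 * (m - a))) iY.
rewrite integralD//; last exact: integrableD.
rewrite integralD// integralZl// EY integral_cst//= nuT mule1 -EFinM -EFinD.
rewrite -[leRHS]adde0 leeD2l// lee_fin; have := sqr_ge0 (m - a); lra.
Qed.

End mean_square.

Section conditional_mean.
Context d d1 d2 (T : measurableType d) (T1 : measurableType d1)
  (T2 : measurableType d2) (R : realType) (P : probability T R)
  (Z : {mfun T >-> T1}) (U : T -> T2) (kappa : R.-pker T1 ~> T2).
Hypotheses (mU : measurable_fun setT U)
  (kappaP : is_conditional_law P Z U kappa).

Lemma measurable_kernel_mean (X : T2 -> R) : measurable_fun setT X ->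
  measurable_fun setT (fun z => Rintegral (kappa z) setT X).
Proof.
move=> mX; rewrite /Rintegral; apply: measurableT_comp => //.
under eq_fun do rewrite integralE.
apply: emeasurable_funB; apply: measurable_fun_integral_kernel => //.
- exact: measurable_kernel.
- by apply: measurable_funepos; exact/measurable_EFinP.
- exact: measurable_kernel.
- by apply: measurable_funeneg; exact/measurable_EFinP.
Qed.

(** No measurable function of the data is closer to [X \o U] in mean square
    than the conditional mean: given the data, this is the minimality of the
    mean under [kappa (Z w)]. *)
Lemma conditional_mean_best (X : T2 -> R) (v : T1 -> R) :
  measurable_fun setT X -> measurable_fun setT v ->
  (\int[P]_w ((X (U w) - Rintegral (kappa (Z w)) setT X) ^+ 2)%:E <=
   \int[P]_w ((X (U w) - v (Z w)) ^+ 2)%:E)%E.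
Proof.
move=> mX mv.
have disint (g : T1 -> R) : measurable_fun setT g ->
    (\int[P]_w ((X (U w) - g (Z w)) ^+ 2)%:E =
     \int[P]_w \int[kappa (Z w)]_x ((X x - g (Z w)) ^+ 2)%:E)%E /\
    measurable_fun setT (fun z => \int[kappa z]_x ((X x - g z) ^+ 2)%:E)%E.
  move=> mg; pose f (zx : T1 * T2) := ((X zx.2 - g zx.1) ^+ 2)%:E.
  have mf : measurable_fun setT f.
    apply/measurable_EFinP; apply: measurable_funX; apply: measurable_funB.
      exact: measurableT_comp.
    exact: measurableT_comp.
  have f0 z : (0 <= f z)%E by rewrite lee_fin sqr_ge0.
  split; first exact: (ge0_conditional_expectation mU kappaP mf).
  exact: (measurable_fun_integral_finite_kernel f kappa).
have [-> mm] := disint _ (measurable_kernel_mean mX).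
have [-> mv'] := disint _ mv.
apply: ge0_le_integral => //.
- by move=> w _; apply: integral_ge0 => x _; rewrite lee_fin sqr_ge0.
- exact: measurableT_comp mm _.
- exact: measurableT_comp mv' _.
- by move=> w _; apply: integral_sqr_sub_mean_le => //; exact: prob_kernel.
Qed.

End conditional_mean.

(** * Integrals of functions of column vectors *)

Section measurable_column_vectors.
Context {R : realType} {d : measure_display} {T : measurableType d}.

Lemma measurable_fun_coord n (f : T -> 'cV[R]_n) i :
  measurable_fun setT f -> measurable_fun setT (fun w => f w i 0).
Proof. by move=> mf; exact: (measurableT_comp (measurable_coord i 0)). Qed.

Lemma measurable_fun_cvD n (f g : T -> 'cV[R]_n) :
  measurable_fun setT f -> measurable_fun setT g ->
  measurable_fun setT (fun w => f w + g w).
Proof.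
move=> mf mg; apply: measurable_fun_mx => i j; rewrite ord1.
under eq_fun do rewrite mxE.
by apply: measurable_funD; exact: measurable_fun_coord.
Qed.

Lemma measurable_fun_mulmx n p (A : 'M[R]_(n, p)) (f : T -> 'cV[R]_p) :
  measurable_fun setT f -> measurable_fun setT (fun w => A *m f w).
Proof.
move=> mf; apply: measurable_fun_mx => i j; rewrite ord1.
under eq_fun do rewrite mxE.
apply: measurable_sum => k; apply: measurable_funM => //.
exact: measurable_fun_coord.
Qed.

Lemma measurable_fun_cvB n (f g : T -> 'cV[R]_n) :
  measurable_fun setT f -> measurable_fun setT g ->
  measurable_fun setT (fun w => f w - g w).
Proof.
move=> mf mg; apply: measurable_fun_cvD => //.
under eq_fun => w do rewrite -[g w]mul1mx -mulNmx; exact: measurable_fun_mulmx.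
Qed.

Lemma measurable_fun_sqnorm n (f : T -> 'cV[R]_n) :
  measurable_fun setT f -> measurable_fun setT (fun w => sqnorm (f w)).
Proof.
move=> mf; apply: measurable_sum => i; apply: measurable_funX.
exact: measurable_fun_coord.
Qed.

Lemma measurable_fun_is_norm_sqr n (N : 'cV[R]_n -> R) (f : T -> 'cV[R]_n) :
  is_norm N -> measurable_fun setT f ->
  measurable_fun setT (fun w => N (f w) ^+ 2).
Proof.
move=> N_norm mf; apply: measurable_funX; apply: measurableT_comp mf.
by apply: continuous_measurable_mx; exact: is_norm_continuous.
Qed.

End measurable_column_vectors.

Section integral_bounds.
Context {R : realType} {d : measure_display} {T : measurableType d}
  (mu : {measure set T -> \bar R}).

Lemma ge0_integral_le_comb (X Y1 Y2 : T -> R) (a b : R) :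
  measurable_fun setT X -> measurable_fun setT Y1 -> measurable_fun setT Y2 ->
  (forall w, 0 <= X w) -> (forall w, 0 <= Y1 w) -> (forall w, 0 <= Y2 w) ->
  0 <= a -> 0 <= b -> (forall w, X w <= a * Y1 w + b * Y2 w) ->
  (\int[mu]_w (X w)%:E <=
   a%:E * \int[mu]_w (Y1 w)%:E + b%:E * \int[mu]_w (Y2 w)%:E)%E.
Proof.
move=> mX mY1 mY2 X0 Y10 Y20 a0 b0 le.
rewrite -!ge0_integralZl_EFin//; last 4 first.
- by move=> w _; rewrite lee_fin.
- exact/measurable_EFinP.
- by move=> w _; rewrite lee_fin.
- exact/measurable_EFinP.
rewrite -ge0_integralD//; last 4 first.
- by move=> w _; rewrite -EFinM lee_fin mulr_ge0.
- by apply: measurable_funeM; exact/measurable_EFinP.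
- by move=> w _; rewrite -EFinM lee_fin mulr_ge0.
- by apply: measurable_funeM; exact/measurable_EFinP.
apply: ge0_le_integral => //.
- by move=> w _; rewrite lee_fin.
- exact/measurable_EFinP.
- by apply: emeasurable_funD; apply: measurable_funeM; exact/measurable_EFinP.
- by move=> w _; rewrite -!EFinM -EFinD lee_fin.
Qed.

Lemma ge0_integral_le_scale (X Y : T -> R) (a : R) :
  measurable_fun setT X -> measurable_fun setT Y ->
  (forall w, 0 <= X w) -> (forall w, 0 <= Y w) -> 0 <= a ->
  (forall w, X w <= a * Y w) ->
  (\int[mu]_w (X w)%:E <= a%:E * \int[mu]_w (Y w)%:E)%E.
Proof.
move=> mX mY X0 Y0 a0 le.
have := @ge0_integral_le_comb X Y (cst 0) a 0 mX mY (measurable_cst _) X0 Y0.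
by rewrite mul0e adde0; apply=> // w; rewrite mul0r addr0.
Qed.

Lemma integral_sqnorm n (f : T -> 'cV[R]_n) : measurable_fun setT f ->
  (\int[mu]_w (sqnorm (f w))%:E = \sum_i \int[mu]_w (f w i 0 ^+ 2)%:E)%E.
Proof.
move=> mf; rewrite -ge0_integral_sum//.
- by apply: eq_integral => w _; rewrite /sqnorm sumEFin.
- move=> i; apply/measurable_EFinP; apply: measurable_funX.
  exact: measurable_fun_coord.
- by move=> i w _; rewrite lee_fin sqr_ge0.
Qed.

End integral_bounds.

(** * Mean square error of the 3DVAR filter *)

Lemma limn_esup_le_near (R : realType) (u : (\bar R)^nat) (l : \bar R) :
  (\forall k \near \oo, u k <= l)%E -> (limn_esup u <= l)%E.
Proof.
move=> ul; apply: (@le_trans _ _ (ereal_sup (u @` [set k | (u k <= l)%E]))).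
  by apply: ereal_inf_lbound; exists [set k | (u k <= l)%E].
by apply: ge_ereal_sup => _ [k ukl <-].
Qed.

(** The 3DVAR filter, started at 0: the state estimate is propagated by [psi]
    and corrected with a constant gain [K]; the matrix [A] stands for
    [I - K H], and the observation [s j] enters at time [j.+1]. *)
Fixpoint observer {R : realType} {n m : nat} (psi : 'cV[R]_n -> 'cV[R]_n)
    (A : 'M[R]_n) (K : 'M[R]_(n, m)) (s : nat -> 'cV[R]_m) (k : nat) :
    'cV[R]_n :=
  if k is j.+1 then A *m psi (observer psi A K s j) + K *m s j else 0.

Section observer_theory.
Context {R : realType} {n m : nat} {psi : 'cV[R]_n -> 'cV[R]_n}.
Context {A : 'M[R]_n} {K : 'M[R]_(n, m)}.

Lemma eq_observer (s s' : nat -> 'cV[R]_m) k :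
  (forall j, (j < k)%N -> s j = s' j) ->
  observer psi A K s k = observer psi A K s' k.
Proof.
elim: k => [//|k ih] ss' /=; rewrite ss'// ih// => j jk.
by apply: ss'; exact: ltnW.
Qed.

Lemma measurable_observer d (T : measurableType d) (s : T -> nat -> 'cV[R]_m) k :
  measurable_fun setT psi ->
  (forall j, (j < k)%N -> measurable_fun setT (s ^~ j)) ->
  measurable_fun setT (fun w => observer psi A K (s w) k).
Proof.
move=> mpsi; elim: k => [|k ih] ms /=; first exact: measurable_cst.
apply: measurable_fun_cvD; apply: measurable_fun_mulmx; last exact: ms.
by apply: measurableT_comp => //; apply: ih => j jk; apply: ms; exact: ltnW.
Qed.

Lemma observer_error (H : 'M[R]_(m, n)) (v psiu xi : 'cV[R]_n) (eta : 'cV[R]_m) :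
  A = 1%:M - K *m H ->
  (psiu + xi) - (A *m psi v + K *m (H *m (psiu + xi) + eta)) =
  (A *m psiu - A *m psi v) + (A *m xi - K *m eta).
Proof.
move=> AE; have AX (x : 'cV[R]_n) : A *m x = x - K *m (H *m x).
  by rewrite AE mulmxBl mul1mx mulmxA.
rewrite (AX psiu) (AX xi) !mulmxDr.
move: (A *m _) (K *m (H *m psiu)) (K *m (H *m xi)) (K *m eta) => a b c e.
by apply/matrixP => i j; rewrite !mxE; ring.
Qed.

End observer_theory.

Lemma convex_sqr_le (R : realFieldType) (a x y : R) : 0 <= a < 1 ->
  (a * x + y) ^+ 2 <= a * x ^+ 2 + (1 - a)^-1 * y ^+ 2.
Proof.
move=> /andP[a0 a1]; have b0 : 0 < 1 - a by lra.
rewrite -subr_ge0.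
have -> : a * x ^+ 2 + (1 - a)^-1 * y ^+ 2 - (a * x + y) ^+ 2 =
   a / (1 - a) * ((1 - a) * x - y) ^+ 2.
  by field; rewrite gt_eqF.
by rewrite mulr_ge0 ?sqr_ge0// divr_ge0// ltW.
Qed.

Lemma gaussian_sqnorm_le (R : realType) d (T : measurableType d)
    (P : probability T R) n (S : 'M[R]_n) (g : R) (X : {RV P >-> 'cV[R]_n}) :
  0 < g -> posdefmx S ->
  centered_gaussian (g ^+ 2 *: S) (distribution P X) ->
  (\int[P]_w (sqnorm (X w))%:E <= (g ^+ 2 * (4 * Num.sqrt 2 * \tr S))%:E)%E.
Proof.
move=> g0 Spos gX; rewrite integral_sqnorm//.
rewrite /mxtrace 2!mulr_sumr -sumEFin; apply: lee_sum => i _.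
have gS : 0 < (g ^+ 2 *: S) i i.
  by rewrite mxE mulr_gt0 ?exprn_gt0//; exact: posdefmx_diag_gt0.
have := gaussian_coord_second_moment_le gS gX.
by rewrite mxE mulrCA.
Qed.

Lemma affine_recursion_le (R : realType) (S : (\bar R)^nat) (a b D : R) :
  0 <= a < 1 -> 0 <= D -> (S 1%N <= b%:E)%E ->
  (forall k, S k.+1 <= a%:E * S k + D%:E)%E ->
  forall k, (S k.+1 <= (a ^+ k * b + D / (1 - a))%:E)%E.
Proof.
move=> /andP[a0 a1] D0 S1 rec; elim=> [|k ih].
  rewrite expr0 mul1r (le_trans S1)// lee_fin lerDl divr_ge0// subr_ge0 ltW//.
rewrite (le_trans (rec _))//.
have -> : a ^+ k.+1 * b + D / (1 - a) = a * (a ^+ k * b + D / (1 - a)) + D.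
  by rewrite exprS; field; rewrite gt_eqF// subr_gt0.
by rewrite EFinD EFinM leeD2r// lee_wpmul2l// lee_fin.
Qed.

Section observer_error_bound.
Context (R : realType) (n m : nat) (psi : 'cV[R]_n -> 'cV[R]_n)
  (H : 'M[R]_(m, n)) (K : 'M[R]_(n, m)) (N : 'cV[R]_n -> R).
Hypotheses (psi_meas : measurable_fun setT psi) (N_norm : is_norm N).
Context (d : measure_display) (T : measurableType d) (P : probability T R)
  (u xi : nat -> {RV P >-> 'cV[R]_n}) (y eta : nat -> {RV P >-> 'cV[R]_m}).
Hypotheses (state : forall k w, u k.+1 w = psi (u k w) + xi k w)
  (obs : forall k w, y k.+1 w = H *m u k.+1 w + eta k.+1 w).

Local Notation A := (1%:M - K *m H).
(** The estimate computed from the observations, its error, and the noise that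
    enters the error in one step. *)
Let v k w := observer psi A K (fun j => y j.+1 w) k.
Let e k w := u k w - v k w.
Let zeta k w := A *m xi k w - K *m eta k.+1 w.

Let eS k w : e k.+1 w = (A *m psi (u k w) - A *m psi (v k w)) + zeta k w.
Proof. by rewrite /e /v /= obs !state observer_error. Qed.

Lemma measurable_observer_error k : measurable_fun setT (e k).
Proof.
apply: measurable_fun_cvB => //; exact: measurable_observer.
Qed.

Let measurable_zeta k : measurable_fun setT (zeta k).
Proof. by apply: measurable_fun_cvB; exact: measurable_fun_mulmx. Qed.

Lemma noise_mean_square_le (CA CK a b : R) k : 0 <= CA -> 0 <= CK ->
  (forall x, N (A *m x) ^+ 2 <= CA * sqnorm x) ->
  (forall x, N (K *m x) ^+ 2 <= CK * sqnorm x) ->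
  (\int[P]_w (sqnorm (xi k w))%:E <= a%:E)%E ->
  (\int[P]_w (sqnorm (eta k.+1 w))%:E <= b%:E)%E ->
  (\int[P]_w (N (zeta k w) ^+ 2)%:E <= (2 * CA * a + 2 * CK * b)%:E)%E.
Proof.
move=> CA0 CK0 hA hK ha hb.
apply: (@le_trans _ _ ((2 * CA)%:E * \int[P]_w (sqnorm (xi k w))%:E +
   (2 * CK)%:E * \int[P]_w (sqnorm (eta k.+1 w))%:E)%E).
  apply: ge0_integral_le_comb.
  - exact: measurable_fun_is_norm_sqr.
  - exact: measurable_fun_sqnorm.
  - exact: measurable_fun_sqnorm.
  - by move=> w; exact: sqr_ge0.
  - by move=> w; exact: sqnorm_ge0.
  - by move=> w; exact: sqnorm_ge0.
  - by rewrite mulr_ge0.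
  - by rewrite mulr_ge0.
  move=> w; have := hA (xi k w); have := hK (eta k.+1 w).
  have := is_normB_le N_norm (A *m xi k w) (K *m eta k.+1 w); rewrite -/(zeta k w).
  have := is_norm_ge0 N_norm (zeta k w).
  move: (N (zeta k w)) (N (A *m _)) (N (K *m _)) => z p q z0 zpq q2 p2.
  have z2 : z ^+ 2 <= (p + q) ^+ 2 by rewrite lerXn2r ?nnegrE//; lra.
  have := sqr_ge0 (p - q); move: z2; rewrite sqrrD sqrrB; lra.
by rewrite EFinD !(EFinM _ a) !(EFinM _ b); apply: leeD; apply: lee_wpmul2l => //;
  rewrite lee_fin mulr_ge0.
Qed.

Lemma observer_mean_square_step (a D : R) k : 0 <= a < 1 ->
  (forall x x', N (A *m psi x - A *m psi x') <= a * N (x - x')) ->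
  (\int[P]_w (N (zeta k w) ^+ 2)%:E <= D%:E)%E ->
  (\int[P]_w (N (e k.+1 w) ^+ 2)%:E <=
   a%:E * \int[P]_w (N (e k w) ^+ 2)%:E + (D / (1 - a))%:E)%E.
Proof.
move=> a01 lip hD; have /andP[a0 a1] := a01.
have b0 : 0 <= (1 - a)^-1 by rewrite invr_ge0 subr_ge0 ltW.
apply: (@le_trans _ _ (a%:E * \int[P]_w (N (e k w) ^+ 2)%:E +
   ((1 - a)^-1)%:E * \int[P]_w (N (zeta k w) ^+ 2)%:E)%E).
  apply: ge0_integral_le_comb => //.
  - by apply: measurable_fun_is_norm_sqr => //; exact: measurable_observer_error.
  - by apply: measurable_fun_is_norm_sqr => //; exact: measurable_observer_error.
  - exact: measurable_fun_is_norm_sqr.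
  - by move=> w; exact: sqr_ge0.
  - by move=> w; exact: sqr_ge0.
  - by move=> w; exact: sqr_ge0.
  move=> w; rewrite (le_trans _ (convex_sqr_le _ _ a01))//.
  rewrite lerXn2r ?nnegrE ?is_norm_ge0//.
    by rewrite addr_ge0 ?mulr_ge0 ?is_norm_ge0.
  rewrite eS; case: (N_norm) => ND _ _; rewrite (le_trans (ND _ _))//.
  by rewrite lerD2r; exact: lip.
by rewrite leeD2l// mulrC EFinM lee_wpmul2l// lee_fin.
Qed.

(** Boundedness of [psi] makes the error square integrable after one step,
    whatever the initial law. *)
Lemma observer_mean_square_init (M CA D : R) : 0 <= CA ->
  (forall x, `|psi x| <= M) ->
  (forall x, N (A *m x) ^+ 2 <= CA * sqnorm x) ->
  (\int[P]_w (N (zeta 0%N w) ^+ 2)%:E <= D%:E)%E ->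
  (\int[P]_w (N (e 1%N w) ^+ 2)%:E <=
   (2 * (CA * (n%:R * (2 * M) ^+ 2)) + 2 * D)%:E)%E.
Proof.
move=> CA0 psiM hA hD.
have M0 : 0 <= M by rewrite (le_trans _ (psiM 0)).
set B := CA * (n%:R * (2 * M) ^+ 2).
have B0 : 0 <= B by rewrite !mulr_ge0.
apply: (@le_trans _ _ (2%:E * \int[P]_w B%:E +
   2%:E * \int[P]_w (N (zeta 0%N w) ^+ 2)%:E)%E).
  apply: (ge0_integral_le_comb _ (Y1 := cst B)) => //.
  - by apply: measurable_fun_is_norm_sqr => //; exact: measurable_observer_error.
  - exact: measurable_fun_is_norm_sqr.
  - by move=> w; exact: sqr_ge0.
  - by move=> w; exact: sqr_ge0.
  move=> w; rewrite eS -mulmxBr.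
  set x := psi _ - psi _; case: (N_norm) => ND _ _.
  have xB : N (A *m x) ^+ 2 <= B.
    rewrite (le_trans (hA _))// ler_wpM2l// (le_trans (sqnorm_le_normr _))//.
    rewrite ler_wpM2l// lerXn2r ?nnegrE ?mulr_ge0//.
    by rewrite (le_trans (ler_normB _ _))// mulr_natl mulr2n lerD.
  have := is_norm_ge0 N_norm (A *m x + zeta 0%N w).
  have := ND (A *m x) (zeta 0%N w); move: xB.
  move: (N (A *m x + _)) (N (A *m x)) (N (zeta _ _)) => z p q p2 zpq z0 /=.
  have z2 : z ^+ 2 <= (p + q) ^+ 2 by rewrite lerXn2r ?nnegrE//; lra.
  have := sqr_ge0 (p - q); move: z2; rewrite sqrrD sqrrB; lra.
rewrite integral_cst//= probability_setT mule1.
rewrite (EFinD (2 * B)) (EFinM 2 B) (EFinM 2 D); apply: leeD => //.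
by rewrite lee_wpmul2l// lee_fin.
Qed.

End observer_error_bound.

(** * The filter mean *)

(** For a general norm the conditional mean is optimal up to the constants
    comparing that norm with the Euclidean one. *)
Lemma conditional_mean_norm_le (R : realType) d d1 (T : measurableType d)
    (T1 : measurableType d1) (P : probability T R) n (N : 'cV[R]_n -> R)
    (C1 C2 : R) (Z : {mfun T >-> T1}) (U : T -> 'cV[R]_n)
    (kappa : R.-pker T1 ~> 'cV[R]_n) (g : T1 -> 'cV[R]_n) :
  is_norm N -> 0 <= C1 -> 0 <= C2 ->
  (forall x, N x ^+ 2 <= C1 * sqnorm x) ->
  (forall x, sqnorm x <= C2 * N x ^+ 2) ->
  measurable_fun setT U -> measurable_fun setT g ->
  is_conditional_law P Z U kappa ->
  (\int[P]_w (N (U w - mean (kappa (Z w))) ^+ 2)%:E <=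
   (C1 * C2)%:E * \int[P]_w (N (U w - g (Z w)) ^+ 2)%:E)%E.
Proof.
move=> N_norm C10 C20 hC1 hC2 mU mg kP.
have mm : measurable_fun setT (fun z => mean (kappa z)).
  apply: measurable_fun_mx => i j; under eq_fun do rewrite mxE.
  by apply: measurable_kernel_mean; exact: measurable_coord.
have mUm : measurable_fun setT (fun w => U w - mean (kappa (Z w))).
  apply: measurable_fun_cvB => //; exact: (measurableT_comp mm).
have mUg : measurable_fun setT (fun w => U w - g (Z w)).
  apply: measurable_fun_cvB => //; exact: (measurableT_comp mg).
apply: (@le_trans _ _ (C1%:E * \int[P]_w (sqnorm (U w - mean (kappa (Z w))))%:E)%E).
  apply: ge0_integral_le_scale => //.
  - exact: measurable_fun_is_norm_sqr.
  - exact: measurable_fun_sqnorm.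
  - by move=> w; exact: sqr_ge0.
  - by move=> w; exact: sqnorm_ge0.
apply: (@le_trans _ _ (C1%:E * \int[P]_w (sqnorm (U w - g (Z w)))%:E)%E).
  apply: lee_wpmul2l; first by rewrite lee_fin.
  rewrite !integral_sqnorm//; apply: lee_sum => i _.
  have := conditional_mean_best mU kP (measurable_coord i 0)
    (measurable_fun_coord i mg).
  have coordB (x y : 'cV[R]_n) j : (x - y) j 0 = x j 0 - y j 0 by rewrite !mxE.
  under [in X in _ -> (X <= _)%E]eq_integral do rewrite coordB mxE.
  by under [in X in _ -> (_ <= X)%E]eq_integral do rewrite coordB.
rewrite EFinM -muleA; apply: lee_wpmul2l; first by rewrite lee_fin.
apply: ge0_integral_le_scale => //.
- exact: measurable_fun_sqnorm.
- exact: measurable_fun_is_norm_sqr.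
- by move=> w; exact: sqnorm_ge0.
- by move=> w; exact: sqr_ge0.
Qed.

Lemma measurable_data d (T : measurableType d) (R : realType)
    (P : probability T R) m (y : nat -> {RV P >-> 'cV[R]_m}) k :
  measurable_fun setT (data y k).
Proof.
apply/measurable_fun_tnthP => i.
rewrite (_ : _ \o _ = y i.+1) //.
by apply/funext => w; rewrite /= /data tnth_mktuple.
Qed.

Unset Implicit Arguments.
Set Strict Implicit.

Theorem theorem2p7 (R : realType) (n m : nat)
    (psi : 'cV[R]_n -> 'cV[R]_n) (H : 'M[R]_(m, n))
    (Sigma0 : 'M[R]_n) (Gamma0 : 'M[R]_m) (mu0 : probability 'cV[R]_n R)
    (N : 'cV[R]_n -> R) (rc : R)
    (psi_meas : measurable_fun [set: 'cV[R]_n] psi)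
    (psi_bounded : bounded_fun psi)
    (Sigma0_pos : posdefmx Sigma0) (Gamma0_pos : posdefmx Gamma0)
    (N_norm : is_norm N) (rc_gt0 : 0 < rc)
    (contr : contraction_assumption psi H Sigma0 Gamma0 N rc) :
  forall r : R, 0 <= r < rc ->
  exists c : R, forall sigma gamma : R,
    0 < sigma -> 0 < gamma -> sigma / gamma = r ->
  forall (d : measure_display) (T : measurableType d) (P : probability T R)
    (u xi : nat -> {RV P >-> 'cV[R]_n}) (y eta : nat -> {RV P >-> 'cV[R]_m}),
    gaussian_model psi H (sigma ^+ 2 *: Sigma0) (gamma ^+ 2 *: Gamma0) mu0
      u xi y eta ->
  forall mu : forall k : nat, R.-pker (k.-tuple 'cV[R]_m) ~> 'cV[R]_n,
    (forall k, is_conditional_law P (data y k) (u k) (mu k)) ->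
  (limn_esup (fun k =>
     'E_P[fun w => (N (u k w - mean (mu k (data y k w))) ^+ 2)%R])
   <= (c * gamma ^+ 2)%:E)%E.
Proof.
move=> r r_rc; have [alpha alpha1 lipf] := contr r r_rc.
pose K := kalman_gain H (r ^+ 2 *: Sigma0) Gamma0.
pose A : 'M[R]_n := 1%:M - K *m H.
pose a := Num.max alpha 0.
have a01 : 0 <= a < 1 by rewrite le_max lexx orbT gt_max alpha1 ltr01.
have /andP[a0 a1] := a01; have a1' : 0 < 1 - a by rewrite subr_gt0.
have lip x x' : N (A *m psi x - A *m psi x') <= a * N (x - x').
  by rewrite (le_trans (lipf x x'))// ler_wpM2r ?is_norm_ge0// le_max lexx.
have [C1 C10 hC1] := is_norm_sqnorm_le N_norm.
have [C2 C20 hC2] := sqnorm_is_norm_le N_norm.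
have [CA CA0 hA] := is_norm_mulmx_sqr N_norm A.
have [CK CK0 hK] := is_norm_mulmx_sqr N_norm K.
have [M psiM] : exists M, forall x, `|psi x| <= M.
  have [M [_ hM]] := psi_bounded; exists (M + 1) => x.
  by apply: (hM (M + 1)) => //; rewrite ltrDl.
have tr0 p (S : 'M[R]_p) : posdefmx S -> 0 <= \tr S.
  by move=> Spos; apply: sumr_ge0 => i _; rewrite ltW// posdefmx_diag_gt0.
pose D0 : R := 2 * CA * (r ^+ 2 * (4 * Num.sqrt 2 * \tr Sigma0)) +
               2 * CK * (4 * Num.sqrt 2 * \tr Gamma0).
have D00 : 0 <= D0.
  by rewrite addr_ge0// !mulr_ge0 ?sqrtr_ge0 ?tr0 ?exprn_ge0//; case/andP: r_rc.
(* The summand 1 absorbs the transient [a ^+ k * b] of the recursion. *)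
exists (C1 * C2 * (D0 / (1 - a) / (1 - a) + 1)) => sigma gamma s0 g0 sg.
move=> d T P u xi y eta model mu muP.
have sE : sigma = r * gamma by rewrite -sg divfK// gt_eqF.
have [st ob _ noise obs_noise _] := model.
pose v k w := observer psi A K (fun j => y j.+1 w) k.
pose S k : \bar R := (\int[P]_w (N (u k w - v k w) ^+ 2)%:E)%E.
have hzeta k :
    (\int[P]_w (N (A *m xi k w - K *m eta k.+1 w) ^+ 2)%:E <=
     (gamma ^+ 2 * D0)%:E)%E.
  have -> : gamma ^+ 2 * D0 =
      2 * CA * (sigma ^+ 2 * (4 * Num.sqrt 2 * \tr Sigma0)) +
      2 * CK * (gamma ^+ 2 * (4 * Num.sqrt 2 * \tr Gamma0)).
    by rewrite /D0 sE; ring.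
  exact: (noise_mean_square_le N_norm CA0 CK0 hA hK
    (gaussian_sqnorm_le s0 Sigma0_pos (noise k))
    (gaussian_sqnorm_le g0 Gamma0_pos (obs_noise k))).
have S1 : exists b : R, (S 1%N <= b%:E)%E.
  eexists; exact: (observer_mean_square_init psi_meas N_norm st ob CA0 psiM hA
    (hzeta 0%N)).
have Sstep k : (S k.+1 <= a%:E * S k + (gamma ^+ 2 * D0 / (1 - a))%:E)%E.
  exact: (observer_mean_square_step psi_meas N_norm st ob a01 lip (hzeta k)).
have [b hb] := S1.
have Dge0 : 0 <= gamma ^+ 2 * D0 / (1 - a).
  by rewrite divr_ge0 ?mulr_ge0 ?sqr_ge0// ltW.
have Sle := affine_recursion_le a01 Dge0 hb Sstep.
apply: limn_esup_le_near.
have : \forall k \near \oo, b * a ^+ k <= gamma ^+ 2.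
  have /cvgr_le : geometric b a @ \oo --> (0 : R).
    by apply: cvg_geometric; rewrite ger0_norm.
  by apply; rewrite exprn_gt0.
case=> k0 _ hk0; exists k0.+1 => // -[//|k] /= k0k.
rewrite unlock.
pose Z_mixin := isMeasurableFun.Build _ _ _ _ (data y k.+1)
  (@measurable_data _ _ _ _ _ y k.+1).
pose Z : {mfun T >-> k.+1.-tuple 'cV[R]_m} := HB.pack (data y k.+1) Z_mixin.
(* The observer as a function of the first [k.+1] observations only. *)
pose g (z : k.+1.-tuple 'cV[R]_m) := observer psi A K (nth 0 z) k.+1.
have mg : measurable_fun setT g.
  apply: measurable_observer => // j jk.
  rewrite [X in measurable_fun _ X](_ : _ = fun z => tnth z (Ordinal jk)).
    exact: measurable_tnth.
  by apply/funext => z; rewrite (tnth_nth 0).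
have := conditional_mean_norm_le (Z := Z) N_norm C10 C20 hC1 hC2
  (measurable_funPT (u k.+1)) mg (muP k.+1).
move=> /le_trans; apply.
have -> : (\int[P]_w (N (u k.+1 w - g (Z w)) ^+ 2)%:E = S k.+1)%E.
  apply: eq_integral => w _; rewrite /g /v.
  rewrite (@eq_observer _ _ _ psi A K (nth 0 (Z w)) (fun j => y j.+1 w) k.+1)//
    => j jk.
  rewrite /Z/=.
  by rewrite -(tnth_nth 0 (data y k.+1 w) (Ordinal jk)) tnth_mktuple.
rewrite -(mulrA (C1 * C2)) (EFinM (C1 * C2)).
apply: lee_wpmul2l; first by rewrite lee_fin mulr_ge0.
rewrite (le_trans (Sle k))// lee_fin.
rewrite mulrDl mul1r mulrC addrC lerD//; last by apply: hk0.
by rewrite le_eqVlt; apply/orP; left; apply/eqP; ring.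
Qed.
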